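(* Let $L,m,n\ge1$ be integers and let $y=mn$. As $\mathbf{r}\to\mathbf{0}$ (through vectors with positive entries), the diversity order $d_{opt}^K(\mathbf{r})$ satisfies $$\lim_{\mathbf{r}\to\mathbf{0}}d_{opt}^K(\mathbf{r})=\begin{cases}mn & \text{if }K=1,\\ 2mn&\text{if }K>1.\end{cases}$$ Furthermore, writing $C_{m,n,K}(\mathbf{0})$ and $\overline{C}_{m,n,K}(\mathbf{0})$ for the limits of $C_{m,n,K}(\mathbf{r})$ and $\overline{C}_{m,n,K}(\mathbf{r})$ as $\mathbf{r}\to\mathbf{0}$, $$C_{m,n,K}(\mathbf{0})=mn\left(\frac{(mn)^K-1}{mn-1}\right)\quad\text{for }K\ge1$$ (where for $mn=1$ the fraction is read as $\sum_{j=0}^{K-1}(mn)^j=K$), and $$\overline{C}_{m,n,K}(\mathbf{0})=\begin{cases}mn&\text{if }K=1,\\ mn(1+mn)&\text{if }K>1.\end{cases}$$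
   Context: Setting: a multiple access channel with $L$ users, each with $m$ transmit antennas, a receiver with $n$ antennas, i.i.d. Rayleigh fading, and $K$ quantized feedback indices received in error with probability $\epsilon\doteq\mathsf{SNR}^{-y}$ ($K=1$ means no feedback). The vector of multiplexing gains is $\mathbf{r}=(r_1,\dots,r_L)$, $r_s>0$. $\mathbf{1}$ is the all-ones vector of length $L$. The function $D$ (outage-probability exponent at rates $r_s\log\mathsf{SNR}$ and powers of order $\mathsf{SNR}^p$): for $p>0$, $$D(\mathbf{r},\mathbf{1}p)=\min_{\emptyset\ne S\subseteq\{1,\dots,L\}}G_{|S|m,n}\Big(\sum_{i\in S}r_i,p\Big),$$ where, for positive integers $a,b$, with $q=\min(a,b)$, $M=\max(a,b)$ and $r>0$, $$G_{a,b}(r,p)=\inf\Big\{\sum_{i=1}^{q}(2i-1+M-q)\alpha_i:\ \alpha_1\ge\dots\ge\alpha_q\ge0,\ \sum_{i=1}^q(p-\alpha_i)^+<r\Big\},\quad x^+=\max(x,0).$$ Recursions: $C_{m,n,0}(\mathbf{r})=\overline{C}_{m,n,0}(\mathbf{r})=0$ and for $j\ge1$ $$C_{m,n,j}(\mathbf{r})=D(\mathbf{r},\mathbf{1}(1+C_{m,n,j-1}(\mathbf{r}))),\qquad \overline{C}_{m,n,j}(\mathbf{r})=D(\mathbf{r},\mathbf{1}(1+\min(y,\overline{C}_{m,n,j-1}(\mathbf{r})))).$$ Diversity order with $K$ feedback indices: $d_{opt}^1(\mathbf{r})=D(\mathbf{r},\mathbf{1})$ (no feedback), and for $K>1$, $d_{opt}^K(\mathbf{r})=\min(\overline{C}_{m,n,K}(\mathbf{r}),\,y+C_{m,n,1}(\mathbf{r}))$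 (the achievable diversity order). *)

(* Defs.v *)
From HB Require Import structures.
From mathcomp Require Import all_boot all_order all_algebra.
From mathcomp Require Import all_classical all_reals all_analysis.
Set Implicit Arguments.
Unset Strict Implicit.
Unset Printing Implicit Defensive.
Import Order.TTheory GRing.Theory Num.Theory.
Import numFieldNormedType.Exports.
Local Open Scope classical_set_scope.
Local Open Scope ring_scope.

(* Outage exponent of an [a x b] Rayleigh link at multiplexing gain [r] and
   power [SNR ^ p]. The index [i : 'I_q] is [i.+1] in one-based numbering, so
   the weight [2 (i+1) - 1 + M - q] is [2 i + 1 + (M - q)]. For [0 < r] the
   feasible set is nonempty (take [alpha] constantly [max p 0]) and the costs are
   nonnegative, so the real-valued [inf] is a genuine infimum. *)
Definition G_feasible (R : realType) (q : nat) (r p : R) (alpha : 'I_q -> R)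
    : Prop :=
  [/\ forall i j : 'I_q, (i <= j)%N -> alpha j <= alpha i,
      forall i : 'I_q, 0 <= alpha i
    & \sum_(i < q) Num.max (p - alpha i) 0 < r].

Definition G_cost (R : realType) (a b : nat) (alpha : 'I_(minn a b) -> R) : R :=
  \sum_(i < minn a b) (2 * i + 1 + (maxn a b - minn a b))%:R * alpha i.

Definition G (R : realType) (a b : nat) (r p : R) : R :=
  inf [set G_cost alpha | alpha in @G_feasible R (minn a b) r p].

(* Minimum over the nonempty sets of users. The seed of the iterated minimum is
   the value at the full set of users, which for [0 < L] is one of the terms. *)
Definition D (R : realType) (L m n : nat) (r : 'rV[R]_L) (p : R) : R :=
  \big[Num.min/G (L * m) n (\sum_(i < L) r 0 i) p]_(S : {set 'I_L} | S != finset.set0)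
    G (#|S| * m) n (\sum_(i in S) r 0 i) p.

Fixpoint C (R : realType) (L m n j : nat) (r : 'rV[R]_L) : R :=
  if j is j'.+1 then D m n r (1 + C m n j' r) else 0.

Fixpoint Cbar (R : realType) (L m n : nat) (y : R) (j : nat) (r : 'rV[R]_L)
    : R :=
  if j is j'.+1 then D m n r (1 + Num.min y (Cbar m n y j' r)) else 0.

(* Meaningful for [0 < K] only. *)
Definition d_opt (R : realType) (L m n : nat) (y : R) (K : nat) (r : 'rV[R]_L)
    : R :=
  if K == 1%N then D m n r 1
  else Num.min (Cbar m n y K r) (y + C m n 1 r).

Definition positive_near_0 (R : realType) (L : nat) : set_system 'rV[R]_L :=
  within [set r : 'rV[R]_L | forall i : 'I_L, 0 < r 0 i] (nbhs (0 : 'rV[R]_L)).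

(* Main.v *)
(* The weights in the cost of [G_{a,b}] sum to [a b] and are each at most [a + b].
   Since [alpha_i >= p - (p - alpha_i)^+], the cost of a feasible [alpha] is at least
   [a b p - (a + b) r], while the constant vector [alpha = p] is feasible of cost
   exactly [a b p]. So [G_{a,b}(r, p)] is within [(a + b) r] of [a b p], uniformly in
   [p >= 0]; the minimum defining [D] is then attained at singletons up to [O(|r|)],
   and [D(r, p_r) -> m n l] whenever [p_r -> l]. All three limits follow by
   iterating this. *)
Require Import Defs.
From HB Require Import structures.
From mathcomp Require Import all_boot all_order all_algebra.
From mathcomp Require Import all_classical all_reals all_analysis.
From mathcomp Require Import zify ring.
Import Order.TTheory GRing.Theory Num.Theory.
Import numFieldNormedType.Exports.
Local Open Scope classical_set_scope.
Local Open Scope ring_scope.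

Lemma sum_odd_shift (d q : nat) :
  (\sum_(i < q) (2 * i + 1 + d) = q * (q + d))%N.
Proof.
elim: q => [|q IHq]; first by rewrite big_ord0.
by rewrite big_ord_recr /= IHq; lia.
Qed.

Lemma sum_G_weights (a b : nat) :
  (\sum_(i < minn a b) (2 * i + 1 + (maxn a b - minn a b)) = a * b)%N.
Proof.
rewrite sum_odd_shift subnKC; last exact: leq_trans (geq_minl a b) (leq_maxl a b).
by case: leqP => _ //; rewrite mulnC.
Qed.

Lemma G_cost_ge0 (R : realType) (a b : nat) (r p : R) alpha :
  G_feasible r p alpha -> 0 <= @G_cost R a b alpha.
Proof. by case=> _ alpha_ge0 _; apply: sumr_ge0 => i _; rewrite mulr_ge0. Qed.

Lemma G_feasible_const (R : realType) (q : nat) (r p : R) :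
  0 < r -> 0 <= p -> @G_feasible R q r p (fun=> p).
Proof.
move=> r_gt0 p_ge0; split=> //.
by rewrite big1 // => i _; rewrite subrr maxxx.
Qed.

Lemma G_cost_const (R : realType) (a b : nat) (p : R) :
  @G_cost R a b (fun=> p) = (a * b)%:R * p.
Proof. by rewrite /G_cost -mulr_suml -natr_sum sum_G_weights. Qed.

Lemma G_cost_lower (R : realType) (a b : nat) (r p : R) alpha :
  G_feasible r p alpha ->
  (a * b)%:R * p - (a + b)%:R * r <= @G_cost R a b alpha.
Proof.
case=> _ _ /ltW slack_le.
(* Writing [a b p] as the cost of the constant vector makes the gap a single sum of weight times
   [p - alpha i], compared termwise with the slack. *)
rewrite -G_cost_const lerBlDr -lerBlDl /G_cost -sumrB.
apply: le_trans (ler_wpM2l (ler0n _ _) slack_le).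
rewrite mulr_sumr; apply: ler_sum => i _; rewrite -mulrBr.
apply: (@le_trans _ _ ((2 * i + 1 + (maxn a b - minn a b))%:R
                       * Num.max (p - alpha i) 0)).
  by apply: ler_wpM2l => //; rewrite le_max lexx.
apply: ler_wpM2r; first by rewrite le_max lexx orbT.
(* With [q = minn a b], [i < q] gives [2 i + 1 <= 2 q], and [2 q + (maxn a b - q) = a + b]. *)
by rewrite ler_nat; have := ltn_ord i; lia.
Qed.

(** An empty feasible set gives [inf = 0]. This makes [C] and [Cbar] nonnegative at every [r], as
    [cvg_D] asks of the powers. *)
Lemma G_ge0 (R : realType) (a b : nat) (r p : R) : 0 <= G a b r p.
Proof.
rewrite /G; set E := [set _ | _ in _].
have [->|/set0P E_neq0] := eqVneq E set0; first by rewrite inf0.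
by apply: lb_le_inf => // _ [alpha Halpha <-]; exact: G_cost_ge0 Halpha.
Qed.

Lemma G_le (R : realType) (a b : nat) (r p : R) :
  0 < r -> 0 <= p -> G a b r p <= (a * b)%:R * p.
Proof.
move=> r_gt0 p_ge0; rewrite -G_cost_const; apply: ge_inf.
  by exists 0 => _ [alpha Halpha <-]; exact: G_cost_ge0 Halpha.
by exists (fun=> p) => //; exact: G_feasible_const.
Qed.

Lemma G_ge (R : realType) (a b : nat) (r p : R) : 0 < r -> 0 <= p ->
  (a * b)%:R * p - (a + b)%:R * r <= G a b r p.
Proof.
move=> r_gt0 p_ge0; apply: lb_le_inf.
  by exists (@G_cost R a b (fun=> p)), (fun=> p) => //; exact: G_feasible_const.
by move=> _ [alpha Halpha <-]; exact: G_cost_lower Halpha.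
Qed.

Lemma D_ge0 (R : realType) (L m n : nat) (r : 'rV[R]_L) (p : R) :
  0 <= D m n r p.
Proof. by apply: le_bigmin => [|S _]; exact: G_ge0. Qed.

Lemma D_le (R : realType) (L m n : nat) (r : 'rV[R]_L) (p : R) :
  (0 < L)%N -> (forall i, 0 < r 0 i) -> 0 <= p ->
  D m n r p <= (m * n)%:R * p.
Proof.
move=> L_gt0 r_gt0 p_ge0; pose i0 := Ordinal L_gt0.
have neq0 : [set i0]%SET != finset.set0.
  by apply/set0Pn; exists i0; rewrite inE.
apply: le_trans (@bigmin_le_cond _ _ _ _ _ (fun S => S != finset.set0) _ neq0) _.
by rewrite cards1 mul1n big_set1; exact: G_le.
Qed.

Lemma D_ge (R : realType) (L m n : nat) (r : 'rV[R]_L) (p : R) :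
  (0 < L)%N -> (forall i, 0 < r 0 i) -> 0 <= p ->
  (m * n)%:R * p - (L * m + n)%:R * (\sum_i r 0 i) <= D m n r p.
Proof.
move=> L_gt0 r_gt0 p_ge0.
(* The main term uses [#|S| >= 1]; the error term uses [#|S| <= L] and the positivity of the rates
   outside [S]. *)
have G_user_ge (S : {set 'I_L}) : S != finset.set0 ->
    (m * n)%:R * p - (L * m + n)%:R * (\sum_i r 0 i)
    <= G (#|S| * m) n (\sum_(i in S) r 0 i) p.
  move=> S_neq0; have /set0Pn[i0 i0S] := S_neq0.
  have rS_gt0 : 0 < \sum_(i in S) r 0 i.
    rewrite (bigD1 i0) //= ltr_wpDr // sumr_ge0 // => i _; exact: ltW.
  apply: le_trans (G_ge _ _ _ _ _ rS_gt0 p_ge0); apply: lerB.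
    rewrite ler_wpM2r // ler_nat leq_mul2r leq_pmull ?orbT //.
    by rewrite card_gt0.
  apply: ler_pM => //; first exact: ltW.
    by rewrite ler_nat leq_add2r leq_mul2r (leq_trans (max_card _)) ?card_ord ?orbT.
  rewrite [leRHS](bigID (mem S)) /= lerDl.
  by rewrite sumr_ge0 // => i _; exact: ltW.
apply: le_bigmin => //.
(* What remains is the seed of the iterated minimum, which is the term of the full set of users. *)
have setT_neq0 : [set: 'I_L]%SET != finset.set0.
  by apply/set0Pn; exists (Ordinal L_gt0); rewrite inE.
have := G_user_ge _ setT_neq0.
rewrite cardsT card_ord; congr (_ <= G _ _ _ _).
by apply: eq_bigl => i; rewrite inE.
Qed.

Lemma cvg_sum_positive_near_0 (R : realType) (L : nat) :
  \sum_(i < L) (r : 'rV[R]_L) 0 i @[r --> @positive_near_0 R L] --> (0 : R).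
Proof.
have sum0 : \sum_(i < L) (0 : 'rV[R]_L) 0 i = 0.
  by rewrite big1 // => i _; rewrite mxE.
rewrite -[X in _ --> X]sum0; apply: cvg_within_filter.
apply: cvg_big => [|i _]; first exact: add_continuous.
exact: coord_continuous.
Qed.

(** The power varies with [r] because the recursions feed the previous iterate back into [D]. The
    squeeze works since the error bound does not involve the power. *)
Lemma cvg_D (R : realType) (L m n : nat) (p : 'rV[R]_L -> R) (l : R) :
  (0 < L)%N -> (forall r, 0 <= p r) ->
  p r @[r --> @positive_near_0 R L] --> l ->
  D m n r (p r) @[r --> @positive_near_0 R L] --> (m * n)%:R * l.
Proof.
move=> L_gt0 p_ge0 p_cvg.
have p_cvgM : (m * n)%:R * p r @[r --> @positive_near_0 R L] --> (m * n)%:R * l.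
  exact: cvgMr p_cvg.
apply: (@squeeze_cvgr _ _ _ _
  (fun r => (m * n)%:R * p r - (L * m + n)%:R * (\sum_i r 0 i))
  (fun r => (m * n)%:R * p r)) => //.
  apply: filterS (withinT _ (nbhs_filter _)) => r r_gt0.
  by rewrite D_ge ?D_le.
rewrite -[X in _ --> X]subr0 -[X in _ - X](mulr0 (L * m + n)%:R).
by apply: cvgB => //; apply: cvgMr; exact: cvg_sum_positive_near_0.
Qed.

(** Uses [min a b = (a + b - |a - b|) / 2]. *)
Lemma cvg_minr (R : realType) (T : Type) (F : set_system T) {FF : Filter F}
    (f g : T -> R) (a b : R) :
  f x @[x --> F] --> a -> g x @[x --> F] --> b ->
  Num.min (f x) (g x) @[x --> F] --> Num.min a b.
Proof.
move=> f_cvg g_cvg; rewrite minr_absE; under eq_fun do rewrite minr_absE.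
by apply: cvgMl; apply: cvgB; [exact: cvgD|apply: cvg_norm; exact: cvgB].
Qed.

Lemma C_ge0 (R : realType) (L m n j : nat) (r : 'rV[R]_L) : 0 <= C m n j r.
Proof. by case: j => [|j] //=; exact: D_ge0. Qed.

Lemma Cbar_ge0 (R : realType) (L m n j : nat) (y : R) (r : 'rV[R]_L) :
  0 <= Cbar m n y j r.
Proof. by case: j => [|j] //=; exact: D_ge0. Qed.

Lemma cvg_C (R : realType) (L m n j : nat) : (0 < L)%N ->
  C m n j r @[r --> @positive_near_0 R L] -->
    ((m * n)%:R * \sum_(i < j) (m * n)%:R ^+ i : R).
Proof.
move=> L_gt0; elim: j => [|j IHj] /=.
  by rewrite big_ord0 mulr0; exact: cvg_cst.
(* Peeling off the first power turns the sum into [1 + m n * (shorter sum)], the limit of the power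
   [1 + C m n j r]. *)
rewrite big_ord_recl expr0; under eq_bigr do rewrite exprS.
rewrite -mulr_sumr.
apply: cvg_D => // [r|]; first by rewrite addr_ge0 ?C_ge0.
by apply: cvgD => //; exact: cvg_cst.
Qed.

(** The limits follow [l -> m n (1 + min (m n) l)] from [0]. The first iterate is [m n], and from
    then on [l >= m n], so the minimum saturates at [m n]. *)
Lemma cvg_Cbar (R : realType) (L m n j : nat) : (0 < L)%N -> (0 < m * n)%N ->
  Cbar m n (m * n)%:R j.+1 r @[r --> @positive_near_0 R L] -->
    ((m * n)%:R * (1 + (if j is 0 then 0 else (m * n)%:R)) : R).
Proof.
move=> L_gt0 mn_gt0.
have Cbar_step i (l : R) :
    Cbar m n (m * n)%:R i r @[r --> @positive_near_0 R L] --> l ->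
    Cbar m n (m * n)%:R i.+1 r @[r --> @positive_near_0 R L] -->
      (m * n)%:R * (1 + Num.min (m * n)%:R l).
  move=> i_cvg; apply: cvg_D => // [r|].
    by rewrite addr_ge0 // le_min ler0n Cbar_ge0.
  by apply: cvgD; [exact: cvg_cst|apply: cvg_minr => //; exact: cvg_cst].
elim: j => [|j IHj].
  by rewrite -[X in 1 + X](min_r (ler0n R (m * n))); apply: Cbar_step; exact: cvg_cst.
have := Cbar_step _ _ IHj; rewrite min_l //.
by rewrite ler_peMr // lerDl; case: j {IHj}.
Qed.

Theorem lemma4 (R : realType) (L m n : nat)
    (hL : (1 <= L)%N) (hm : (1 <= m)%N) (hn : (1 <= n)%N)
    (y : R) (hy : y = (m * n)%:R) (K : nat) (hK : (1 <= K)%N) :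
  [/\ d_opt m n y K r @[r --> @positive_near_0 R L] -->
        (if K == 1%N then (m * n)%:R else 2 * (m * n)%:R : R),
      C m n K r @[r --> @positive_near_0 R L] -->
        ((m * n)%:R * (if (m * n == 1)%N then \sum_(j < K) (m * n)%:R ^+ j
                       else ((m * n)%:R ^+ K - 1) / ((m * n)%:R - 1)) : R)
    & Cbar m n y K r @[r --> @positive_near_0 R L] -->
        (if K == 1%N then (m * n)%:R else (m * n)%:R * (1 + (m * n)%:R) : R)].
Proof.
have mn_gt0 : (0 < m * n)%N by rewrite muln_gt0 hm.
have Cbar_cvg : Cbar m n y K r @[r --> @positive_near_0 R L] -->
    (if K == 1%N then (m * n)%:R else (m * n)%:R * (1 + (m * n)%:R) : R).
  rewrite hy; case: K hK => [//|[|K]] _; have := @cvg_Cbar R L m n _ hL mn_gt0.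
    by move/(_ 0); rewrite addr0 mulr1.
  by move/(_ K.+1).
split=> //.
- rewrite /d_opt; case: eqP Cbar_cvg => [_ _|_ Cbar_cvg].
    rewrite -[X in _ --> X]mulr1; apply: cvg_D => //; exact: cvg_cst.
  (* The second argument is [2 m n]; it is the smaller one because [m n >= 1]. *)
  have -> : 2 * (m * n)%:R =
      Num.min ((m * n)%:R * (1 + (m * n)%:R)) (y + (m * n)%:R * 1) :> R.
    rewrite hy min_r; first by ring.
    by rewrite mulrDr mulr1 lerD2l ler_peMr // ler1n.
  apply: cvg_minr => //; apply: cvgD; first exact: cvg_cst.
  by have := @cvg_C R L m n 1 hL; rewrite big_ord1.
- have [_|mn_neq1] := eqVneq; first exact: cvg_C.
  (* Factoring [x ^ K - 1] by [x - 1] reduces the closed form to the geometric sum of [cvg_C]. *)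
  rewrite subrX1 mulrAC divff ?mul1r; first exact: cvg_C.
  by rewrite subr_eq0 pnatr_eq1.
Qed.
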